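(* For every $k\ge0$ and every odd-wedge pattern $\tau\in\mathfrak S_{2k+1}(132)$, $$\mathfrak M_\tau(x)=1+xR_k(x^2).$$
   Context: $\mathfrak S_n$ is the set of permutations of $\{1,\dots,n\}$ (for $n=0$, the empty permutation, which is even). A permutation avoids a pattern $\tau$ of length $\ell$ if none of its length-$\ell$ subsequences is order-isomorphic to $\tau$; $\mathfrak S_n(132)$ is the set of $132$-avoiding permutations in $\mathfrak S_n$. $\mathfrak M_\tau(x)=\mathfrak E_\tau(x)-\mathfrak O_\tau(x)$, where $\mathfrak E_\tau(x)$ (resp. $\mathfrak O_\tau(x)$) is the ordinary generating function in $n$ for the number of even (resp. odd) permutations in $\mathfrak S_n$, $n\ge0$, avoiding both $132$ and $\tau$. A permutation $\tau\in\mathfrak S_\ell$ is a wedge pattern if it can be written as $\tau=(\tau^1,\rho^1,\dots,\tau^r,\rho^r)$ where each $\tau^i$ is nonempty, $(\tau^1,\tau^2,\dots,\tau^r)=(s+1,s+2,\dots,\ell)$ for some $s\ge0$, and $(\rho^1,\dots,\rho^r)$ is a layered permutation of $1,\dots,s$ with layers $\rho^i$: each $\rho^i$ is a (possibly empty) increasing word, and all entries of $\rho^i$ are greater than all entries of $\rho^{j}$ for $i<j$. For example $645783912$ and $456378129$ are wedge patterns. It is an odd-wedge pattern if such a representation exists in which, for every $p=1,\dots,r$, the length of $(\tau^1,\rho^1,\dots,\tau^p,\rho^p)$ is odd. For example $23145$ and $34251$ are odd-wedge patterns. $U_r$ is the Chebyshev polynomial of the second kind: $U_0(t)=1$, $U_1(t)=2t$,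 $U_r(t)=2tU_{r-1}(t)-U_{r-2}(t)$. For $k\ge1$, $R_k(x)=\dfrac{U_{k-1}\left(\frac1{2\sqrt x}\right)}{\sqrt x\,U_k\left(\frac1{2\sqrt x}\right)}$, a rational function of $x$, and $R_0(x)=0$; equivalently $R_k(x)=1/(1-xR_{k-1}(x))$ for $k\ge1$. *)

(* Defs.v *)
From mathcomp Require Import all_boot all_fingroup all_algebra.
From mathcomp Require Import ring.

Set Implicit Arguments.
Unset Strict Implicit.
Unset Printing Implicit Defensive.

Import GRing.Theory.

(* Permutations of {1,...,n} are elements of 'S_n = {perm 'I_n}: the value
   i in the informal notation is the ordinal of value i.-1. *)

Definition contains (l n : nat) (tau : 'S_l) (sigma : 'S_n) : bool :=
  [exists f : {ffun 'I_l -> 'I_n},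
    [forall i : 'I_l, forall j : 'I_l, (i < j) ==> (f i < f j)] &&
    [forall i : 'I_l, forall j : 'I_l, (sigma (f i) < sigma (f j)) == (tau i < tau j)]].

Definition avoids (l n : nat) (tau : 'S_l) (sigma : 'S_n) : bool :=
  ~~ contains tau sigma.

Definition p132 : 'S_3 := tperm (inord 1) (inord 2).

Definition even_avoiders (l : nat) (tau : 'S_l) (n : nat) : {set 'S_n} :=
  [set sigma : 'S_n |
    [&& avoids p132 sigma, avoids tau sigma & ~~ odd_perm sigma]].

Definition odd_avoiders (l : nat) (tau : 'S_l) (n : nat) : {set 'S_n} :=
  [set sigma : 'S_n |
    [&& avoids p132 sigma, avoids tau sigma & odd_perm sigma]].

(* A formal power series is represented by its coefficient sequence. *)
Definition gfE (l : nat) (tau : 'S_l) (n : nat) : int :=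
  (#|even_avoiders tau n|)%:Z.

Definition gfO (l : nat) (tau : 'S_l) (n : nat) : int :=
  (#|odd_avoiders tau n|)%:Z.

Definition gfM (l : nat) (tau : 'S_l) (n : nat) : int :=
  (gfE tau n - gfO tau n)%R.

(* One-line notation, with values in {1,...,l}. *)
Definition perm_word (l : nat) (tau : 'S_l) : seq nat :=
  [seq (tau i).+1 | i <- enum 'I_l].

Definition blocks := seq (seq nat * seq nat).

(* [:: (tau^1, rho^1); ...; (tau^r, rho^r)] as the word
   tau^1 rho^1 ... tau^r rho^r *)
Definition blocks_word (bs : blocks) : seq nat :=
  flatten [seq b.1 ++ b.2 | b <- bs].

Definition wedge_rep (l : nat) (tau : 'S_l) (s : nat) (bs : blocks) : Prop :=
  [/\ perm_word tau = blocks_word bs,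
      all (fun b => b.1 != [::]) bs,
      flatten [seq b.1 | b <- bs] = iota s.+1 (l - s),
      perm_eq (flatten [seq b.2 | b <- bs]) (iota 1 s) &
      all (fun b => sorted ltn b.2) bs /\
      pairwise (fun b c : seq nat * seq nat =>
        allrel (fun x y => y < x) b.2 c.2) bs].

Definition wedge_pattern (l : nat) (tau : 'S_l) : Prop :=
  exists s bs, wedge_rep tau s bs.

Definition odd_wedge_pattern (l : nat) (tau : 'S_l) : Prop :=
  exists s bs, wedge_rep tau s bs /\
    forall p, 0 < p <= size bs -> odd (size (blocks_word (take p bs))).

Local Open Scope ring_scope.

(* Chebyshev polynomials of the second kind *)
Fixpoint chebU (F : nzRingType) (r : nat) : {poly F} :=
  match r with
  | 0 => 1
  | r1.+1 => match r1 with
             | 0 => 2%:R *: 'X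
             | r2.+1 => 2%:R *: 'X * chebU F r1 - chebU F r2
             end
  end.

(* chebR k y is R_k(x) where y is a chosen square root of x, i.e. R_k(y^2):
   U_{k-1}(1/(2y)) / (y U_k(1/(2y))) for k >= 1.  The choice of the root is
   irrelevant (chebRN), and R_k satisfies the recurrence chebR_rec. *)
Definition chebR (F : fieldType) (k : nat) (y : F) : F :=
  match k with
  | 0 => 0
  | k1.+1 => (chebU F k1).[1 / (2%:R * y)] / (y * (chebU F k).[1 / (2%:R * y)])
  end.

Lemma chebU_rec (F : comNzRingType) (r : nat) (t : F) :
  (chebU F r.+2).[t] = 2%:R * t * (chebU F r.+1).[t] - (chebU F r).[t].
Proof. by rewrite [chebU F r.+2]/= !hornerE. Qed.

Lemma chebUN (F : comNzRingType) (r : nat) (t : F) :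
  (chebU F r).[- t] = (-1) ^+ r * (chebU F r).[t].
Proof.
suff: (chebU F r).[- t] = (-1) ^+ r * (chebU F r).[t] /\
      (chebU F r.+1).[- t] = (-1) ^+ r.+1 * (chebU F r.+1).[t] by case.
elim: r => [|r [IH0 IH1]].
  by rewrite /= -!polyC1 !(hornerC, hornerZ, hornerX); split; ring.
split=> //; rewrite !chebU_rec IH0 IH1 !exprS; ring.
Qed.

Lemma chebRN (F : fieldType) (k : nat) (y : F) : chebR k (- y) = chebR k y.
Proof.
case: k => [//|k]; rewrite /chebR.
have -> : 1 / (2%:R * - y) = - (1 / (2%:R * y)) :> F.
  by rewrite mulrN invrN mulrN.
rewrite !chebUN exprS mulN1r mulNr mulrNN mulrCA.
by rewrite -mulf_div divff ?mul1r // expf_neq0 // oppr_eq0 oner_neq0.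
Qed.

Lemma chebR_rec (F : fieldType) (k : nat) (y : F) :
  2%:R != 0 :> F -> y != 0 -> (chebU F k).[1 / (2%:R * y)] != 0 ->
  chebR k.+1 y = 1 / (1 - y ^+ 2 * chebR k y).
Proof.
move=> n2 ny; set t := 1 / _.
have yt : y * (2%:R * t) = 1.
  by rewrite /t; field; apply/andP; split.
case: k => [|k] nU.
  by rewrite /chebR -/t /= -!polyC1 !(hornerC, hornerZ, hornerX) yt mulr0 subr0.
rewrite {1}/chebR -/t chebU_rec mulrBr (mulrA y) yt mul1r /chebR -/t.
set u := (chebU F k.+1).[t] in nU *; set v := (chebU F k).[t].
have -> : 1 - y ^+ 2 * (v / (y * u)) = (u - y * v) / u.
  by field; apply/andP; split.
by rewrite mul1r invf_div.
Qed.

(* The rational function field Q(x) and its indeterminate *)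
Definition ratfun := {fraction {poly rat}}.

Definition ratX : ratfun := tofrac 'X.

(* The rational function f is regular at 0 and the power series with
   coefficients a is its expansion there: f = p / q with q(0) != 0 and
   q * a = p as power series. *)
Definition expands_to (f : ratfun) (a : nat -> int) : Prop :=
  exists p q : {poly rat},
    [/\ q.[0] != 0, f = tofrac p / tofrac q &
        forall n, \sum_(i < n.+1) q`_i * (a (n - i)%N)%:~R = p`_n].

(* Main.v *)
Require Import Defs.
From mathcomp Require Import all_boot all_fingroup all_algebra.
From HB Require Import structures.
From mathcomp Require Import boolp ring zify.

(** Write [M_tau] for the signed counting series of the permutations that avoid 132
    and [tau], one with [i] inversions being counted as [(-1)^i].

    A nonempty 132-avoiding permutation is, in a unique way, [a' N b] where [N] is
    its maximum, [b] avoids 132 and [a'] is a 132-avoiding [a] raised above [b]; it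
    has [inv a + inv b + |b| (|a| + 1)] inversions.  If [tau = p L q] with [L] its
    maximum, [p] above [q] and [q] increasing, then [tau] occurs in [a' N b] when
    it occurs in [a], or in [b], or when [p] occurs in [a] and [q] in [b]: the cut
    after [L] is the only one that can put everything before it above everything
    after it ([occurs_split_pivot]).  Hence ([signed_avoiders_rec])
      [M_tau = 1 + x (M_p * M_tau + (M_tau - M_p) * M_q)]
    where [*] is the product of series twisted by the sign [(-1)^(j (i + 1))] on
    the terms of degrees [i] and [j].  The equation has only one solution.  The
    twist is mild: an odd [f] acts by [f g], an even one by [f(x) g(-x)].

    The words [p] met on the way have series that depend on their length only:
      [1 + x r_j]                             for length [2 j + 1],
      [(r_j + x r_j^2) / (1 + x^2 r_j^2)]     for length [2 j],
    where [r_j] is [R_j(x^2)].  These solve the equation when [tau = p L q] with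
    [p] and [q] of lengths of the same parity (hence [tau] of odd length), and when
    [q] is empty.  The verification rests on two addition formulas for the
    continued fractions [r_j] ([chebRs_addS], [chebRs_add]).

    An odd-wedge pattern is built by these two operations.  Reading its blocks from
    left to right, the entries of [tau^i] but the last are new maxima, appended one
    by one; the last one, [L], comes with [rho^i] as [q].  At that point the word
    read has the parity of [rho^i], because the length at the end of the block is
    odd ([odd_wedge_blocks]).

    Finally [x^k U_k(1 / (2 x))] is a polynomial [D_k] in [x^2] with [D_k(0) = 1],
    and [r_k = D_(k-1) / D_k], both as series and in the field of fractions. *)

Set Implicit Arguments.
Unset Strict Implicit.
Unset Printing Implicit Defensive.

Import GRing.Theory Num.Theory.

(** * Occurrences of patterns in words *)

Definition same_order (u v : nat * nat) : bool :=
  ((u.1 < v.1) == (u.2 < v.2)) && ((v.1 < u.1) == (v.2 < u.2)).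

(** Entries of a word may be equal, hence the two comparisons in [same_order].
    Stated with [pairwise], the relation is decided block by block on a
    concatenation. *)
Definition order_iso (p s : seq nat) : bool :=
  (size p == size s) && pairwise same_order (zip p s).

Definition occurs (p w : seq nat) : bool :=
  [exists m : (size w).-tuple bool, order_iso p (mask m w)].

Lemma occursP p w :
  reflect (exists2 s, subseq s w & order_iso p s) (occurs p w).
Proof.
apply: (iffP existsP) => [[m iso_p] | [s /subseqP[m sz_m ->] iso_p]].
  by exists (mask m w); rewrite ?mask_subseq.
by exists (Tuple (introT eqP sz_m)).
Qed.

Lemma order_iso_size p s : order_iso p s -> size p = size s.
Proof. by case/andP=> /eqP. Qed.

(** The form of order isomorphism used to assemble and to cut occurrences: only
    the comparisons across the cut have to be examined. *)
Lemma order_iso_cat p1 p2 s1 s2 : size p1 = size s1 ->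
  order_iso (p1 ++ p2) (s1 ++ s2) =
  [&& order_iso p1 s1, order_iso p2 s2
    & allrel same_order (zip p1 s1) (zip p2 s2)].
Proof.
move=> eqsz; rewrite /order_iso !size_cat zip_cat // pairwise_cat eqsz eqxx.
rewrite eqn_add2l /=.
by case: (size p2 == _); case: (allrel _ _ _); rewrite ?andbF ?andbT.
Qed.

Lemma order_iso_catl p1 p2 s : order_iso (p1 ++ p2) s ->
  let: (s1, s2) := (take (size p1) s, drop (size p1) s) in
  order_iso p1 s1 /\ order_iso p2 s2.
Proof.
move=> iso_p; have := order_iso_size iso_p; rewrite size_cat => sz_s.
move: iso_p; rewrite -{1}(cat_take_drop (size p1) s) order_iso_cat.
  by case/and3P.
by rewrite size_takel // -sz_s leq_addr.
Qed.

Lemma occurs_catl p1 p2 w : occurs (p1 ++ p2) w -> occurs p1 w.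
Proof.
case/occursP=> s sub_sw /order_iso_catl[iso1 _]; apply/occursP.
by exists (take (size p1) s); rewrite // (subseq_trans (take_subseq _ _)).
Qed.

Lemma occurs_catr p1 p2 w : occurs (p1 ++ p2) w -> occurs p2 w.
Proof.
case/occursP=> s sub_sw /order_iso_catl[_ iso2]; apply/occursP.
by exists (drop (size p1) s); rewrite // (subseq_trans (drop_subseq _ _)).
Qed.

Lemma occurs_subseq p w w' : subseq w w' -> occurs p w -> occurs p w'.
Proof.
move=> sub_ww' /occursP[s sub_sw iso_p]; apply/occursP.
by exists s; rewrite // (subseq_trans sub_sw).
Qed.

Lemma order_isoP p s : reflect (size p = size s /\
    forall i j, i < size p -> j < size p ->
      (nth 0 p i < nth 0 p j) = (nth 0 s i < nth 0 s j))
  (order_iso p s).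
Proof.
apply: (iffP andP) => [[/eqP eqsz /(pairwiseP (0, 0)) iso] | [eqsz iso]].
  split=> // i j lti ltj.
  have sz_zip : size (zip p s) = size p by rewrite size_zip eqsz minnn.
  have {}iso i' j' : i' < size p -> j' < size p -> i' < j' ->
      same_order (nth 0 p i', nth 0 s i') (nth 0 p j', nth 0 s j').
    by move=> lti' ltj' /iso; rewrite !inE !nth_zip // sz_zip; apply.
  case: (ltngtP i j) => [/iso|/iso|->]; last by rewrite !ltnn.
    by case/(_ lti ltj)/andP => /eqP.
  by case/(_ ltj lti)/andP => _ /eqP.
rewrite eqsz eqxx; split=> //; apply/(pairwiseP (0, 0)) => i j.
rewrite !inE size_zip eqsz minnn -eqsz => lti ltj _.
by rewrite /same_order !nth_zip //= !iso ?eqxx.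
Qed.

Lemma order_iso_mono (f : nat -> nat) p s : {mono f : i j / i < j} ->
  order_iso p (map f s) = order_iso p s.
Proof.
move=> fmono; apply/order_isoP/order_isoP; rewrite size_map => -[eqsz iso].
  split=> // i j lti ltj; rewrite iso //.
  by rewrite !(nth_map 0) -?eqsz ?fmono.
split=> // i j lti ltj; rewrite iso //.
by rewrite !(nth_map 0) -?eqsz ?fmono.
Qed.

Lemma occurs_mono (f : nat -> nat) p w : {mono f : i j / i < j} ->
  occurs p (map f w) = occurs p w.
Proof.
move=> fmono; apply/occursP/occursP => -[s sub_s iso_p].
  case/subseqP: sub_s => m; rewrite size_map => sz_m def_s.
  exists (mask m w); first exact: mask_subseq.
  by rewrite -(order_iso_mono _ _ fmono) map_mask -def_s.
by exists (map f s); [apply: map_subseq | rewrite order_iso_mono].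
Qed.

Lemma order_iso_sym p s : order_iso p s = order_iso s p.
Proof.
by apply/order_isoP/order_isoP => -[eqsz iso]; split=> // i j;
  rewrite ?eqsz -?eqsz => lti ltj; rewrite iso // ?eqsz // -eqsz.
Qed.

Lemma occurs_map_pattern (f : nat -> nat) p w : {mono f : i j / i < j} ->
  occurs (map f p) w = occurs p w.
Proof.
move=> fmono; apply/occursP/occursP => -[s sub_s iso_s]; exists s => //.
  by rewrite order_iso_sym -(order_iso_mono _ _ fmono) order_iso_sym.
by rewrite order_iso_sym order_iso_mono // order_iso_sym.
Qed.

Lemma subseq_catP (s w1 w2 : seq nat) : subseq s (w1 ++ w2) ->
  exists s1 s2 : seq nat, [/\ s = s1 ++ s2, subseq s1 w1 & subseq s2 w2].
Proof.
case/subseqP=> m; rewrite size_cat => sz_m ->.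
exists (mask (take (size w1) m) w1), (mask (drop (size w1) m) w2).
rewrite !mask_subseq; split=> //.
rewrite -{1}(cat_take_drop (size w1) m) mask_cat // size_takel // sz_m.
exact: leq_addr.
Qed.

Lemma in_zip (p s : seq nat) u : u \in zip p s -> u.1 \in p /\ u.2 \in s.
Proof.
elim: p s => [|x p IHp] [|y s] //=; rewrite !inE => /predU1P[-> /=|/IHp[-> ->]].
  by rewrite !eqxx.
by rewrite !orbT.
Qed.

Lemma gtn_asym m n : m < n -> (n < m) = false.
Proof. by move/ltnW; rewrite ltnNge => ->. Qed.

Section WedgeSplit.

Variables (p q : seq nat) (L : nat).
Hypotheses (p_lt_L : all (ltn^~ L) p) (q_lt_L : all (ltn^~ L) q).
Hypotheses (p_gt_q : allrel (fun x y => y < x) p q) (q_sorted : sorted ltn q).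

Variables (a b : seq nat) (N : nat).
Hypotheses (a_lt_N : all (ltn^~ N) a) (b_lt_N : all (ltn^~ N) b).
Hypotheses (a_gt_b : allrel (fun x y => y < x) a b).

Lemma nth_pLq_lt i : i != size p -> i < (size p + size q).+1 ->
  nth 0 (p ++ L :: q) i < L.
Proof.
rewrite nth_cat; case: (ltngtP i (size p)) => // [ltip _ _ | ltpi _].
  by move/all_nthP: p_lt_L; apply.
rewrite -(subnKC ltpi) addSn subSn ?leq_addr // addKn /= ltnS ltn_add2l => lti.
by move/all_nthP: q_lt_L; apply.
Qed.

Lemma nth_pLq_L : nth 0 (p ++ L :: q) (size p) = L.
Proof. by rewrite nth_cat ltnn subnn. Qed.

(** Inside [q] the word increases, so it cannot be cut there into a higher left
    part and a lower right part. *)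
Lemma nth_q_mono i j : size p < i -> i < j -> j < (size p + size q).+1 ->
  nth 0 (p ++ L :: q) i < nth 0 (p ++ L :: q) j.
Proof.
move=> ltpi ltij ltj; have ltpj := ltn_trans ltpi ltij.
rewrite !nth_cat ![_ < size p]ltnNge (ltnW ltpi) (ltnW ltpj) /=.
rewrite -(subnKC ltpi) -(subnKC ltpj) !addSn !subSn ?leq_addr // !addKn /=.
by apply: (sorted_ltn_nth ltn_trans 0 q_sorted); rewrite ?inE; lia.
Qed.

(** An occurrence is cut by [N] into a part in [a] and a part in [b].  If it uses
    [N], then [N] plays the maximum [L].  Otherwise the part in [a] lies above the
    part in [b]; the only cut of [p L q] with this property and both sides
    nonempty is just after [L], as [L] cannot be on the right and [q] increases. *)
Lemma occurs_split_pivot :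
  occurs (p ++ L :: q) (a ++ N :: b) =
  [|| occurs (p ++ L :: q) a, occurs (p ++ L :: q) b | occurs p a && occurs q b].
Proof.
apply/idP/or3P; last first.
  case=> [/occurs_subseq->//|/occurs_subseq->//|/andP[]].
  - exact: prefix_subseq.
  - by rewrite -cat1s catA suffix_subseq.
  case/occursP=> s1 sub1 iso1 /occursP[s2 sub2 iso2]; apply/occursP.
  exists (s1 ++ N :: s2); first by apply: cat_subseq; rewrite //= eqxx.
  rewrite (order_iso_cat _ _ (order_iso_size iso1)) iso1 -(cat1s L) -(cat1s N).
  rewrite order_iso_cat //= iso2 /=.
  have in1 u : u \in zip p s1 -> [/\ u.1 < L, u.2 < N, u.1 \in p & u.2 \in a].
    case/in_zip=> pu /(mem_subseq sub1) su.
    by split=> //; [apply: (allP p_lt_L) | apply: (allP a_lt_N)].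
  have in2 u : u \in zip q s2 -> [/\ u.1 < L, u.2 < N, u.1 \in q & u.2 \in b].
    case/in_zip=> pu /(mem_subseq sub2) su.
    by split=> //; [apply: (allP q_lt_L) | apply: (allP b_lt_N)].
  rewrite allrel1l allrel_consr /=; apply/and3P; split; apply/allP => u.
  - by case/in2=> ltL ltN _ _; rewrite /same_order /= ltL ltN !(gtn_asym ltL, gtn_asym ltN).
  - by case/in1=> ltL ltN _ _; rewrite /same_order /= ltL ltN !(gtn_asym ltL, gtn_asym ltN).
  move=> /in1[_ _ pu au]; apply/allP => v /in2[_ _ qv bv].
  have lt1 := allrelP p_gt_q _ _ pu qv; have lt2 := allrelP a_gt_b _ _ au bv.
  by rewrite /same_order lt1 lt2 !(gtn_asym lt1, gtn_asym lt2).
case/occursP=> _ /subseq_catP[s1 [s' [-> sub1 sub']]] iso_tau.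
have /order_isoP[] := iso_tau; rewrite !size_cat /= addnS => sz iso.
(* [s1] is the part of the occurrence in [a], [s'] the part in [N b]. *)
have {sub'} [sub' | [s2 def_s' sub2]] : subseq s' b \/
    exists2 s2 : seq nat, s' = N :: s2 & subseq s2 b.
- case: s' sub' {iso_tau sz iso} => [|c s2] /=; first by left; apply: sub0seq.
  by case: eqP => [-> | _]; [right; exists s2 | left].
- have iso_sep i j : i < size s1 -> size s1 <= j -> j < (size p + size q).+1 ->
    nth 0 (p ++ L :: q) j < nth 0 (p ++ L :: q) i.
    move=> lti lej ltj; rewrite iso //; last by lia.
    have ltjs : j - size s1 < size s' by lia.
    rewrite !nth_cat lti (ltnNge j (size s1)) lej /=; apply: (allrelP a_gt_b).
      by rewrite (mem_subseq sub1) ?mem_nth.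
    by rewrite (mem_subseq sub') ?mem_nth.
  case: (posnP (size s1)) => [/size0nil s1_nil | s1_gt0].
    by constructor 2; apply/occursP; exists s'; rewrite // -[s']cat0s -s1_nil.
  case: (posnP (size s')) => [/size0nil s'_nil | s'_gt0].
    by constructor 1; apply/occursP; exists s1; rewrite // -[s1]cats0 -s'_nil.
  (* A cut at or before [L] would put [L] below the first entry of the pattern. *)
  case: (leqP (size s1) (size p)) => [le_s1p | lt_ps1].
    have := iso_sep 0 (size p) s1_gt0 le_s1p; rewrite nth_pLq_L ltnS leq_addr.
    move/(_ isT); have := @nth_pLq_lt 0; lia.
  case: (ltngtP (size s1) (size p).+1) => [|lt_ps1' | eq_s1]; first by lia.
    have := iso_sep (size s1).-1 (size s1).
    have := @nth_q_mono (size s1).-1 (size s1); lia.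
  constructor 3; move: iso_tau; rewrite -cat1s catA order_iso_cat; last first.
    by rewrite size_cat addn1.
  case/and3P=> /order_iso_catl[iso1 _] iso2 _; apply/andP; split; apply/occursP.
    by exists (take (size p) s1); rewrite // (subseq_trans (take_subseq _ _)).
  by exists s'.
(* [N] is the largest entry of the occurrence, hence stands for [L]. *)
have eq_s1 : size s1 = size p.
  apply/eqP/contraT => ne_s1p; move: sz; rewrite def_s' /= addnS => sz.
  have lt_s1 : size s1 < (size p + size q).+1 by lia.
  have lt_p : size p < (size p + size q).+1 by lia.
  have := nth_pLq_lt ne_s1p lt_s1; rewrite -[X in _ < X]nth_pLq_L iso // def_s'.
  rewrite [X in X < _]nth_cat ltnn subnn /= ltnNge => /negP[].
  have: all (leq^~ N) (s1 ++ N :: s2).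
    rewrite all_cat /= leqnn; apply/andP; split; apply/allP => x.
      by move/(mem_subseq sub1)/(allP a_lt_N)/ltnW.
    by move/(mem_subseq sub2)/(allP b_lt_N)/ltnW.
  by move/all_nthP; apply; rewrite size_cat /= addnS -sz.
constructor 3; move: iso_tau; rewrite def_s' order_iso_cat //.
case/and3P=> iso1; rewrite -cat1s => /order_iso_catl[_ /=]; rewrite drop0 => iso2 _.
by apply/andP; split; apply/occursP; [exists s1 | exists s2].
Qed.
End WedgeSplit.

(** * Words avoiding 132 *)

Fixpoint inv_count (w : seq nat) : nat :=
  if w is x :: w' then count (ltn^~ x) w' + inv_count w' else 0.

Lemma inv_count_pivot a b N : all (ltn^~ N) a -> all (ltn^~ N) b ->
  allrel (fun x y => y < x) a b ->
  inv_count (a ++ N :: b) = inv_count a + inv_count b + size b * (size a).+1.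
Proof.
move=> a_lt b_lt; elim: a a_lt => [|x a IHa] /=.
  by move: b_lt; rewrite all_count => /eqP-> _ _; lia.
case/andP=> lt_xN a_lt /andP[gt_xb gt_ab]; rewrite IHa // count_cat /=.
have -> : count (ltn^~ x) b = size b by apply/eqP; rewrite -all_count.
have -> : (N < x) = false by apply: gtn_asym.
by lia.
Qed.

Lemma inv_count_mono (f : nat -> nat) w : {mono f : x y / x < y} ->
  inv_count (map f w) = inv_count w.
Proof.
move=> fmono; elim: w => //= x w ->; rewrite count_map; congr (_ + _).
by apply: eq_count => y /=; rewrite fmono.
Qed.

(** Inverse of the decomposition of a permutation around its maximum, in the case
    where everything to the left of the maximum exceeds everything to its right. *)
Definition glue (a b : seq nat) : seq nat :=
  map (addn (size b)) a ++ size a + size b :: b.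

Definition avoiders n : seq (seq nat) :=
  [seq w <- permutations (iota 0 n) | ~~ occurs [:: 0; 2; 1] w].

Lemma mem_avoiders w n :
  (w \in avoiders n) = ~~ occurs [:: 0; 2; 1] w && perm_eq w (iota 0 n).
Proof. by rewrite mem_filter mem_permutations. Qed.

Lemma perm_iota_lt w n : perm_eq w (iota 0 n) -> all (ltn^~ n) w.
Proof. by move/perm_mem=> eqw; apply/allP => x; rewrite eqw mem_iota. Qed.

Lemma perm_iota_size w m n : perm_eq w (iota m n) -> size w = n.
Proof. by move/perm_size; rewrite size_iota. Qed.

Lemma occurs132P w : reflect
  (exists x y z, subseq [:: x; y; z] w /\ x < z < y) (occurs [:: 0; 2; 1] w).
Proof.
apply: (iffP (occursP _ _)) => [[s sub_s iso_s] | [x [y [z [sub_w /andP[xz zy]]]]]].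
  have := order_iso_size iso_s; case: s => [|x [|y [|z []]]] // in sub_s iso_s *.
  exists x, y, z; split=> //; case/order_isoP: iso_s => _ iso.
  by have := iso 0 2 isT isT; have := iso 2 1 isT isT => /= <- <-.
exists [:: x; y; z]; rewrite // /order_iso /= /same_order /= xz zy.
have xy := ltn_trans xz zy.
by rewrite xy (gtn_asym xz) (gtn_asym zy) (gtn_asym xy).
Qed.

(** When [a] lies above [b], an occurrence of 132 cannot start in [a] and end in
    [b], nor can it use [N] as its last or first entry, so it stays on one side. *)
Lemma occurs132_pivot a b N : all (ltn^~ N) a -> all (ltn^~ N) b ->
  allrel (fun x y => y < x) a b ->
  occurs [:: 0; 2; 1] (a ++ N :: b) =
  occurs [:: 0; 2; 1] a || occurs [:: 0; 2; 1] b.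
Proof.
move=> /allP a_lt /allP b_lt /allrelP a_gt_b; apply/idP/orP; last first.
  case=> /occurs_subseq; apply; first exact: prefix_subseq.
  by rewrite -cat1s catA suffix_subseq.
have bN z : z \in N :: b -> z <= N.
  by rewrite inE => /predU1P[->|/b_lt/ltnW].
case/occurs132P=> x [y [z [/subseq_catP[s1 [s2 [def_s sub1 sub2]]] /andP[xz zy]]]].
case: s1 => [|x1 [|y1 [|z1 s1]]] in def_s sub1; rewrite /= in def_s.
- right; move: sub2; rewrite -def_s /=; case: eqP => [eq_xN sub_yz | _ sub2].
    have : z \in b by rewrite (mem_subseq sub_yz) ?inE ?eqxx ?orbT.
    by move/b_lt; move: xz; rewrite eq_xN /=; lia.
  by apply/occurs132P; exists x, y, z; rewrite xz.
- case: def_s => eq_x def_s2; subst x1 s2.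
  have xa : x \in a by rewrite (mem_subseq sub1) ?inE.
  have zb : z \in b.
    move: sub2; rewrite /=; case: eqP => _ sub2.
      by rewrite (mem_subseq sub2) ?inE.
    by rewrite (mem_subseq sub2) ?inE ?eqxx ?orbT.
  by have := a_gt_b _ _ xa zb; lia.
- case: def_s => eq_x eq_y def_s2; subst x1 y1 s2.
  have xa : x \in a by rewrite (mem_subseq sub1) ?inE ?eqxx.
  have /a_lt /= ya : y \in a by rewrite (mem_subseq sub1) ?inE ?eqxx ?orbT.
  have : z \in N :: b by rewrite (mem_subseq sub2) ?inE.
  rewrite inE => /predU1P[|zb]; first by lia.
  by have := a_gt_b _ _ xa zb; lia.
- left; apply/occurs132P; exists x, y, z; rewrite xz zy; split=> //.
  case: def_s => -> -> -> def_s.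
  by move/esym/nilP: def_s sub1; rewrite /nilp size_cat addn_eq0 => /andP[/nilP->].
Qed.

Section Glue.
Variables (i j : nat) (a b : seq nat).
Hypotheses (a_perm : perm_eq a (iota 0 i)) (b_perm : perm_eq b (iota 0 j)).

Let size_a : size a = i. Proof. exact: perm_iota_size a_perm. Qed.
Let size_b : size b = j. Proof. exact: perm_iota_size b_perm. Qed.

Lemma glue_shape (N := size a + size b) (a' := map (addn (size b)) a) :
  [/\ all (ltn^~ N) a', all (ltn^~ N) b & allrel (fun x y => y < x) a' b].
Proof.
have /allP a_lt := perm_iota_lt a_perm; have /allP b_lt := perm_iota_lt b_perm.
rewrite {}/N {}/a' size_a size_b; split.
- by rewrite all_map; apply/allP => x /a_lt /=; rewrite addnC ltn_add2r.
- by apply/allP => x /b_lt /= lt_xj; apply: leq_trans lt_xj (leq_addl _ _).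
by apply/allrelP => _ y /mapP[x _ ->] /b_lt /= lt_yj; apply: leq_trans lt_yj (leq_addr _ _).
Qed.

Lemma glue_perm : perm_eq (glue a b) (iota 0 (i + j).+1).
Proof.
have -> : iota 0 (i + j).+1 = iota 0 j ++ map (addn j) (iota 0 i) ++ [:: i + j].
  have -> : (i + j).+1 = j + (i + 1) by lia.
  by rewrite -iotaDl addn0 iotaD iotaD (addnC i).
rewrite /glue size_a size_b -cat1s catA perm_catC perm_cat // perm_cat2r.
exact: perm_map.
Qed.

Lemma inv_count_glue :
  inv_count (glue a b) = inv_count a + inv_count b + j * i.+1.
Proof.
have [a_lt b_lt a_gt_b] := glue_shape; rewrite /glue inv_count_pivot //.
rewrite inv_count_mono => [|x y]; last exact: ltn_add2l.
by rewrite size_map size_a size_b.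
Qed.

Lemma occurs132_glue :
  occurs [:: 0; 2; 1] (glue a b) =
  occurs [:: 0; 2; 1] a || occurs [:: 0; 2; 1] b.
Proof.
have [a_lt b_lt a_gt_b] := glue_shape; rewrite occurs132_pivot //.
by rewrite occurs_mono // => x y; apply: ltn_add2l.
Qed.
End Glue.

(** For [y] in [v], all values below [y] are in [v] too, since [u] lies above [v];
    so [v] is an initial segment of the values. *)
Lemma skew_split n u v : perm_eq (u ++ v) (iota 0 n) ->
    allrel (fun x y => y < x) u v ->
  perm_eq v (iota 0 (size v)) /\ perm_eq u (iota (size v) (size u)).
Proof.
move=> perm_uv /allrelP u_gt_v.
have uniq_uv : uniq (u ++ v) by rewrite (perm_uniq perm_uv) iota_uniq.
have v_lt y : y \in v -> y < size v.
  move=> vy; rewrite -[y.+1](size_iota 0); apply: uniq_leq_size.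
    exact: iota_uniq.
  move=> z; rewrite mem_iota /= add0n ltnS => le_zy.
  have lt_yn : y < n.
    by rewrite -[_ < _]/(0 <= y < 0 + n) -mem_iota -(perm_mem perm_uv) mem_cat vy orbT.
  have : z \in u ++ v by rewrite (perm_mem perm_uv) mem_iota; lia.
  by rewrite mem_cat => /orP[/u_gt_v/(_ vy)|//]; lia.
have perm_v : perm_eq v (iota 0 (size v)).
  have uniq_v : uniq v by move: uniq_uv; rewrite cat_uniq => /and3P[].
  apply: uniq_perm; rewrite ?iota_uniq // => y.
  have sub_v : {subset v <= iota 0 (size v)}.
    by move=> z /v_lt; rewrite mem_iota.
  by have [] := uniq_min_size uniq_v sub_v; rewrite ?size_iota.
split=> //; rewrite -(perm_cat2r v) (perm_trans perm_uv) //.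
rewrite perm_sym -(perm_iota_size perm_uv) size_cat addnC iotaD add0n.
by rewrite perm_catC perm_cat2r.
Qed.

Lemma avoiders_uniq n : uniq (avoiders n).
Proof. exact: filter_uniq (permutations_uniq _). Qed.

Definition glued n : seq (seq nat) :=
  [seq glue ab.1 ab.2 | i <- iota 0 n.+1,
     ab <- [seq (a, b) | a <- avoiders i, b <- avoiders (n - i)]].

(** The decomposition around the maximum [n]: [x n y] with [x < y] would be an
    occurrence of 132, so the left part lies above the right one. *)
Lemma perm_avoidersS n : perm_eq (avoiders n.+1) (glued n).
Proof.
apply: uniq_perm; first exact: avoiders_uniq.
  apply: allpairs_uniq_dep; first exact: iota_uniq.
    move=> i _; apply: allpairs_uniq; try exact: avoiders_uniq.
    by move=> [a b] [a' b'].
  have glued_index i (ab : seq nat * seq nat) :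
      ab \in [seq (a, b) | a <- avoiders i, b <- avoiders (n - i)] ->
      i \in iota 0 n.+1 ->
      [/\ i = size ab.1, size ab.1 + size ab.2 = n
        & index n (glue ab.1 ab.2) = size ab.1].
    move=> in_ab; rewrite mem_iota add0n ltnS => /= le_in.
    case/allpairsP: in_ab => -[a b] [/= + + ->] /=; rewrite !mem_avoiders.
    case/andP=> _ perm_a /andP[_ perm_b].
    have [sz_a sz_b] := (perm_iota_size perm_a, perm_iota_size perm_b).
    have sz_ab : size a + size b = n by rewrite sz_a sz_b subnKC.
    split=> //; rewrite /glue -sz_ab index_cat /= eqxx addn0 size_map.
    have [/allP a_lt _ _] := glue_shape perm_a perm_b.
    by case: ifP => // /a_lt /=; rewrite ltnn.
  move=> u v /allpairsPdep[i [ab [ini inab ->]]] /allpairsPdep[i' [ab' [ini' inab' ->]]] /= eq_glue.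
  have [def_i sz_ab idx] := glued_index _ _ inab ini.
  have [def_i' sz_ab' idx'] := glued_index _ _ inab' ini'.
  have eq_a : size ab.1 = size ab'.1 by rewrite -idx -idx' eq_glue.
  have eq_b : size ab.2 = size ab'.2.
    by apply: (@addnI (size ab.1)); rewrite sz_ab eq_a sz_ab'.
  rewrite def_i def_i' eq_a; congr Tagged; move/eqP: eq_glue.
  rewrite /glue eqseq_cat ?size_map // eq_b => /andP[/eqP eq_map /eqP[_ eq2]].
  by rewrite [ab]surjective_pairing [ab']surjective_pairing eq2 (inj_map (@addnI _) eq_map).
move=> w; rewrite mem_avoiders; apply/andP/allpairsPdep; last first.
  case=> i [_ [le_in /allpairsP[[a b] [/= + + ->] ->]]] /=.
  rewrite !mem_avoiders => /andP[av_a perm_a] /andP[av_b perm_b].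
  rewrite (occurs132_glue perm_a perm_b) negb_or av_a av_b.
  have := glue_perm perm_a perm_b; rewrite subnKC //.
  by move: le_in; rewrite mem_iota.
case=> av_w perm_w.
have n_in : n \in w by rewrite (perm_mem perm_w) mem_iota /= add0n.
move: av_w perm_w; case/splitPr: n_in => w1 w2 av_w perm_w.
have perm_w12 : perm_eq (w1 ++ w2) (iota 0 n).
  rewrite -(perm_cons n) -cat1s perm_catCA /= (perm_trans perm_w) //.
  by rewrite -[in iota _ _]addn1 iotaD perm_catC.
have := perm_iota_lt perm_w12; rewrite all_cat => /andP[lt_w1 lt_w2].
have gt_w12 : allrel (fun x y => y < x) w1 w2.
  apply/allrelP => x y xw1 yw2; rewrite ltnNge; apply: contra av_w => le_xy.
  apply/occurs132P; exists x, n, y; split; last first.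
    apply/andP; split; last exact: (allP lt_w2).
    rewrite ltn_neqAle le_xy andbT.
    have : uniq (w1 ++ w2) by rewrite (perm_uniq perm_w12) iota_uniq.
    rewrite cat_uniq => /and3P[_ /hasPn/(_ y yw2) /= yw1 _].
    by apply: contraNneq yw1 => <-.
  rewrite -[[:: x; n; y]]/([:: x] ++ n :: [:: y]); apply: cat_subseq.
    by rewrite sub1seq.
  by rewrite /= eqxx sub1seq.
have [perm_w2 perm_w1] := skew_split perm_w12 gt_w12.
have sz_w12 : size w1 + size w2 = n by rewrite -size_cat (perm_iota_size perm_w12).
pose a := map (subn^~ (size w2)) w1.
have def_w1 : w1 = map (addn (size w2)) a.
  rewrite -map_comp -[LHS]map_id; apply/eq_in_map => x.
  by rewrite (perm_mem perm_w1) mem_iota /= => /andP[le_x _]; rewrite subnKC.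
have perm_a : perm_eq a (iota 0 (size w1)).
  apply: (perm_map_inj (@addnI (size w2))); rewrite -def_w1 -iotaDl addn0.
  exact: perm_w1.
have sz_a : size a = size w1 by rewrite size_map.
exists (size w1), (a, w2); split.
- by rewrite mem_iota add0n ltnS -sz_w12 leq_addr.
- rewrite allpairs_f // mem_avoiders.
    rewrite perm_a andbT; apply: contra av_w => occ_a.
    apply: occurs_subseq (prefix_subseq _ _) _; rewrite def_w1 occurs_mono //.
    by move=> x y; apply: ltn_add2l.
  rewrite -sz_w12 addKn perm_w2 andbT.
  by apply: contra av_w; apply: occurs_subseq; rewrite -cat1s catA suffix_subseq.
- rewrite /glue [(a, w2).1]/= [(a, w2).2]/= sz_a sz_w12.
  by rewrite {1}def_w1.
Qed.

(** * Permutations as words *)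

Definition word n (s : 'S_n) : seq nat := [seq val (s i) | i <- enum 'I_n].

Lemma size_word n (s : 'S_n) : size (word s) = n.
Proof. by rewrite size_map size_enum_ord. Qed.

Lemma nth_word n (s : 'S_n) (i : 'I_n) : nth 0 (word s) i = s i.
Proof. by rewrite (nth_map i) ?size_enum_ord ?nth_ord_enum. Qed.

Lemma word_inj n : injective (@word n).
Proof.
move=> s t eq_st; apply/permP => i; apply: val_inj.
by rewrite /= -!nth_word eq_st.
Qed.

Lemma word_perm_iota n (s : 'S_n) : perm_eq (word s) (iota 0 n).
Proof.
rewrite -val_enum_ord /word (map_comp val s); apply: perm_map.
apply: uniq_perm => [||i].
- by rewrite map_inj_uniq; [apply: enum_uniq | apply: perm_inj].
- exact: enum_uniq.
by rewrite mem_enum -[i](permKV s) mem_map ?mem_enum //; apply: perm_inj.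
Qed.

(** An injection between two finite sets of the same cardinality [n!]. *)
Lemma perm_words n :
  perm_eq [seq word s | s : 'S_n] (permutations (iota 0 n)).
Proof.
have uniq_words : uniq [seq word s | s : 'S_n].
  by rewrite map_inj_uniq ?enum_uniq //; apply: word_inj.
have sub_words : {subset [seq word s | s : 'S_n] <= permutations (iota 0 n)}.
  by move=> _ /mapP[s _ ->]; rewrite mem_permutations word_perm_iota.
apply: uniq_perm; rewrite ?permutations_uniq // => w.
have [] // := uniq_min_size uniq_words sub_words.
by rewrite size_permutations ?iota_uniq // size_iota size_map -cardE card_Sn.
Qed.

Definition ord_ltn n : rel 'I_n := fun i j => i < j.
Arguments ord_ltn n i j /.

Lemma ord_ltn_trans n : transitive (@ord_ltn n).
Proof. by move=> i j k; apply: ltn_trans. Qed.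

Lemma sorted_enum_ord n : sorted (@ord_ltn n) (enum 'I_n).
Proof.
rewrite -[sorted _ _]/(sorted (relpre val ltn) (enum 'I_n)) -sorted_map.
by rewrite val_enum_ord iota_ltn_sorted.
Qed.

(** An increasing choice of positions is the same as a subsequence of the word.
    Strictly increasing lists of ordinals are the filtered enumerations, which
    gives one direction; masking the enumeration gives the other. *)
Lemma containsE l n (tau : 'S_l) (sigma : 'S_n) :
  contains tau sigma = occurs (word tau) (word sigma).
Proof.
apply/existsP/occursP => [[f /andP[/forallP f_mono /forallP f_iso]] | [s sub_s iso_s]].
  pose t := [seq f i | i <- enum 'I_l].
  exists [seq val (sigma i) | i <- t].
    apply: map_subseq; suff -> : t = [seq i <- enum 'I_n | i \in t].
      exact: filter_subseq.
    apply: (irr_sorted_eq (@ord_ltn_trans n)) => [i|||i].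
    - exact: ltnn.
    - apply: (homo_sorted (e := @ord_ltn l)) (sorted_enum_ord l) => i j.
      by move=> ltij; apply: (implyP (forallP (f_mono i) j)).
    - by apply: sorted_filter (sorted_enum_ord n); apply: ord_ltn_trans.
    - by rewrite mem_filter mem_enum andbT.
  have sz_t : size t = l by rewrite size_map size_enum_ord.
  apply/order_isoP; rewrite size_word size_map sz_t; split=> // i j lti ltj.
  have nth_t (k : 'I_l) : nth 0 [seq val (sigma i) | i <- t] k = sigma (f k).
    rewrite -map_comp (nth_map k) ?size_enum_ord //=.
    by rewrite nth_ord_enum.
  rewrite -[i]/(val (Ordinal lti)) -[j]/(val (Ordinal ltj)) !nth_word !nth_t.
  by have /eqP-> := forallP (f_iso (Ordinal lti)) (Ordinal ltj).
have /order_isoP[sz iso] := iso_s.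
case/subseqP: sub_s => m; rewrite size_word => sz_m def_s.
pose t := mask m (enum 'I_n).
have def_st : s = [seq val (sigma i) | i <- t] by rewrite map_mask.
have sz_t : size t == l by rewrite -(size_map (fun i => val (sigma i)) t) -def_st -sz size_word.
have t_sorted : sorted (@ord_ltn n) t.
  exact: subseq_sorted (@ord_ltn_trans n) _ _ (mask_subseq _ _) (sorted_enum_ord n).
pose g (i : 'I_l) : 'I_n := tnth (Tuple sz_t) i.
have gE d i : g i = nth d t i by apply: tnth_nth.
have nth_s k : val (sigma (g k)) = nth 0 s k.
  by rewrite def_st (nth_map (g k)) ?(eqP sz_t) // -gE.
exists [ffun i => g i]; apply/andP.
split; apply/forallP => i; apply/forallP => j; rewrite !ffunE.
  apply/implyP => ltij; pose d := g i; rewrite (gE d i) (gE d j).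
  by apply: (sorted_ltn_nth (@ord_ltn_trans n) _ t_sorted); rewrite ?inE ?(eqP sz_t).
by rewrite !nth_s -!nth_word iso ?size_word.
Qed.

Lemma lift_perm_ord0 n (s : 'S_n.+1) : exists t, s = lift_perm ord0 (s ord0) t.
Proof.
pose f k := odflt k (unlift (s ord0) (s (lift ord0 k))).
have lift_f k : lift (s ord0) (f k) = s (lift ord0 k).
  rewrite /f; case: unliftP => [j -> //|/perm_inj/eqP].
  by rewrite eq_sym (negPf (neq_lift _ _)).
have f_inj : injective f.
  by move=> i j eq_f; apply: (@lift_inj _ ord0); apply: (@perm_inj _ s); rewrite -!lift_f eq_f.
exists (perm f_inj); apply/permP => i; case: (unliftP ord0 i) => [j ->|->].
  by rewrite lift_perm_lift permE lift_f.
by rewrite lift_perm_id.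
Qed.

Lemma word_lift_perm n (j : 'I_n.+1) (t : 'S_n) :
  word (lift_perm ord0 j t) = val j :: map (bump j) (word t).
Proof.
rewrite /word enum_ordSl /= lift_perm_id -!map_comp; congr (_ :: _).
by apply: eq_map => i /=; rewrite lift_perm_lift.
Qed.

(** Removing the first letter [j] of the word removes [j] inversions, and changes
    the signature by [(-1)^j] ([odd_lift_perm]). *)
Lemma odd_perm_inv_count n (s : 'S_n) : odd_perm s = odd (inv_count (word s)).
Proof.
elim: n s => [|n IHn] s.
  have -> : s = 1%g by apply/permP => -[].
  by rewrite odd_perm1 /word (size0nil (size_enum_ord 0)).
have [t def_s] := lift_perm_ord0 s; move: (s ord0) def_s => j ->.
rewrite odd_lift_perm IHn word_lift_perm /= oddD inv_count_mono; last first.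
  by move=> x y; rewrite /bump; lia.
rewrite count_map; congr (odd _ (+) _).
have -> : count (preim (bump j) (ltn^~ j)) (word t) = count (ltn^~ j) (word t).
  by apply: eq_count => x /=; rewrite /bump; lia.
have /seq.permP-> := word_perm_iota t; have := ltn_ord j; rewrite ltnS => le_jn.
rewrite -[X in iota 0 X](subnKC le_jn) iotaD count_cat.
have -> : count (ltn^~ j) (iota 0 j) = j.
  rewrite -[RHS](size_iota 0); apply/eqP; rewrite -all_count.
  by apply/allP => x; rewrite mem_iota.
rewrite (@eq_in_count _ _ pred0) ?count_pred0 ?addn0 // => x.
by rewrite mem_iota /=; lia.
Qed.

Lemma word_p132 : word p132 = [:: 0; 2; 1].
Proof.
rewrite /word; do 3 rewrite enum_ordSl /=; rewrite (size0nil (size_enum_ord 0)) /=.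
by rewrite /p132 !permE /= -!val_eqE /= !inordK.
Qed.

Lemma perm_wordE l (tau : 'S_l) : perm_word tau = map succn (word tau).
Proof. by rewrite /perm_word /word -map_comp. Qed.

Local Open Scope ring_scope.

(** * The ring of formal power series *)

(** A name for sequences that carries the convolution product: the bare function
    type is left free of any ring structure. *)
Definition series (R : Type) := nat -> R.

HB.instance Definition _ (R : Type) := gen_eqMixin (series R).
HB.instance Definition _ (R : Type) := gen_choiceMixin (series R).

Section SeriesRing.
Variable R : comNzRingType.
Implicit Types f g h : series R.

Definition seriesD f g : series R := fun n => f n + g n.
Definition seriesN f : series R := fun n => - f n.
Definition series0 : series R := fun=> 0.

Fact seriesDA : associative seriesD.
Proof. by move=> f g h; apply/funext => n; apply: addrA. Qed.
Fact seriesDC : commutative seriesD.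
Proof. by move=> f g; apply/funext => n; apply: addrC. Qed.
Fact series0D : left_id series0 seriesD.
Proof. by move=> f; apply/funext => n; apply: add0r. Qed.
Fact seriesND : left_inverse series0 seriesN seriesD.
Proof. by move=> f; apply/funext => n; apply: addNr. Qed.

HB.instance Definition _ := GRing.isZmodule.Build (series R)
  seriesDA seriesDC series0D seriesND.

Definition series_poly (p : {poly R}) : series R := fun n => p`_n.

Definition seriesM f g : series R :=
  fun n => \sum_(i < n.+1) f i * g (n - i)%N.
Definition series1 : series R := series_poly 1.

Definition trunc n f : {poly R} := \poly_(i < n.+1) f i.

Lemma coef_trunc n f i : (i <= n)%N -> (trunc n f)`_i = f i.
Proof. by move=> le_in; rewrite coef_poly ltnS le_in. Qed.

(** A coefficient of a product only depends on truncations of the factors, so the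
    ring axioms are inherited from polynomials. *)
Lemma seriesM_coef n f g (p q : {poly R}) :
  (forall i, (i <= n)%N -> p`_i = f i) -> (forall i, (i <= n)%N -> q`_i = g i) ->
  seriesM f g n = (p * q)`_n.
Proof.
move=> Ep Eq; rewrite coefM; apply: eq_bigr => i _.
by rewrite Ep ?Eq ?leq_subr // -ltnS.
Qed.

Lemma coef_truncM n f g i : (i <= n)%N ->
  (trunc n f * trunc n g)`_i = seriesM f g i.
Proof.
move=> le_in; rewrite (@seriesM_coef i f g (trunc n f) (trunc n g)) // => j le_ji;
  by rewrite coef_trunc // (leq_trans le_ji).
Qed.

Fact seriesMA : associative seriesM.
Proof.
move=> f g h; apply/funext => n.
rewrite (seriesM_coef (@coef_trunc n f) (@coef_truncM n g h)) mulrA.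
by rewrite -(seriesM_coef (@coef_truncM n f g) (@coef_trunc n h)).
Qed.
Fact seriesMC : commutative seriesM.
Proof.
move=> f g; apply/funext => n.
by rewrite !(seriesM_coef (@coef_trunc n _) (@coef_trunc n _)) mulrC.
Qed.
Fact series1M : left_id series1 seriesM.
Proof.
move=> f; apply/funext => n.
by rewrite (@seriesM_coef n _ f 1 (trunc n f)) ?mul1r ?coef_trunc // => i;
  exact: coef_trunc.
Qed.
Fact seriesMDl : left_distributive seriesM seriesD.
Proof.
move=> f g h; apply/funext => n; rewrite /seriesM /seriesD -big_split.
by apply: eq_bigr => i _; rewrite mulrDl.
Qed.
Fact series1_neq0 : series1 != 0 :> series R.
Proof.
apply/eqP => /(congr1 (fun f : series R => f 0%N)) /eqP.
by rewrite /series1 /series_poly coef1 oner_eq0.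
Qed.

HB.instance Definition _ := GRing.Zmodule_isComNzRing.Build (series R)
  seriesMA seriesMC series1M seriesMDl series1_neq0.

Lemma seriesP f g : (forall n, f n = g n) -> f = g.
Proof. by move=> eqfg; apply/funext. Qed.

Lemma coefsD f g n : (f + g) n = f n + g n.
Proof. by []. Qed.
Lemma coefsN f n : (- f) n = - f n.
Proof. by []. Qed.
Lemma coefsB f g n : (f - g) n = f n - g n.
Proof. by []. Qed.
Lemma coefsM f g n : (f * g) n = \sum_(i < n.+1) f i * g (n - i)%N.
Proof. by []. Qed.
Lemma coefs1 n : (1 : series R) n = (n == 0%N)%:R.
Proof. by rewrite -[1]/series1 /series1 /series_poly coef1. Qed.

Lemma series_poly_is_zmod_morphism : zmod_morphism series_poly.
Proof. by move=> p q; apply/funext => n; apply: coefB. Qed.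
HB.instance Definition _ := GRing.isZmodMorphism.Build {poly R} (series R)
  series_poly series_poly_is_zmod_morphism.
Lemma series_poly_is_monoid_morphism : monoid_morphism series_poly.
Proof. by split=> // p q; apply/funext => n; apply: coefM. Qed.
HB.instance Definition _ := GRing.isMonoidMorphism.Build {poly R} (series R)
  series_poly series_poly_is_monoid_morphism.

Definition seriesX : series R := series_poly 'X.

Lemma coefsXM f n : (seriesX * f) n.+1 = f n.
Proof.
rewrite coefsM big_ord_recl big_ord_recl big1 => [|i _].
  by rewrite /seriesX /series_poly /= !coefX mul0r mul1r add0r addr0 subSS subn0.
by rewrite /seriesX /series_poly coefX mul0r.
Qed.
Lemma coefsXM0 f : (seriesX * f) 0%N = 0.
Proof. by rewrite coefsM big_ord1 /seriesX /series_poly coefX mul0r. Qed.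

Fixpoint geom_iter f m : series R :=
  if m is m1.+1 then 1 + seriesX * (f * geom_iter f m1) else 0.
(** The inverse of [1 - x f], as the limit of [h |-> 1 + x f h]: the coefficient of
    degree [n] is stationary from the iterate [n + 1] on. *)
Definition geom f : series R := fun n => geom_iter f n.+1 n.

Lemma geom_iter_stable f m m' n :
  (n < m)%N -> (n < m')%N -> geom_iter f m n = geom_iter f m' n.
Proof.
elim: m m' n => [//|m IHm] [//|m'] n; rewrite !ltnS => lenm lenm' /=.
rewrite !coefsD; congr (_ + _); case: n lenm lenm' => [|n] ltnm ltnm'.
  by rewrite !coefsXM0.
rewrite !coefsXM !coefsM; apply: eq_bigr => i _; congr (_ * _).
by apply: IHm; rewrite (leq_ltn_trans (leq_subr _ _)).
Qed.

Lemma geomE f : geom f * (1 - seriesX * f) = 1.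
Proof.
have geom_fix : geom f = 1 + seriesX * (f * geom f).
  apply/seriesP => -[|n]; rewrite {1}/geom /= !coefsD ?coefsXM0 //.
  rewrite !coefsXM !coefsM; congr (_ + _); apply: eq_bigr => i _; congr (_ * _).
  by apply: (@geom_iter_stable f n.+1); rewrite // ltnS leq_subr.
by rewrite mulrBr mulr1 {1}geom_fix; ring.
Qed.

(** The substitution of [-x] for [x]; over a numeric domain, the series it
    fixes are the even ones, and those it negates are the odd ones. *)
Definition conjs f : series R := fun n => (-1) ^+ n * f n.

Lemma conjs_is_zmod_morphism : zmod_morphism conjs.
Proof. by move=> f g; apply/seriesP => n; rewrite coefsB /conjs mulrBr. Qed.
HB.instance Definition _ := GRing.isZmodMorphism.Build (series R) (series R)
  conjs conjs_is_zmod_morphism.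
Lemma conjs_is_monoid_morphism : monoid_morphism conjs.
Proof.
split=> [|f g]; apply/seriesP => n.
  by rewrite /conjs coefs1; case: n => [|n]; rewrite /= ?expr0 ?mulr1 ?mulr0.
rewrite /conjs coefsM mulr_sumr; apply: eq_bigr => -[i /= lt_in] _.
rewrite -{1}(subnKC (ltnSE lt_in)) exprD; ring.
Qed.
HB.instance Definition _ := GRing.isMonoidMorphism.Build (series R) (series R)
  conjs conjs_is_monoid_morphism.

Lemma conjsX : conjs seriesX = - seriesX.
Proof.
apply/seriesP => n; rewrite /conjs coefsN /seriesX /series_poly coefX.
by case: n => [|[|n]] /=; rewrite ?mulr0 ?oppr0 // mulr1.
Qed.

(** The product that counts pairs [(a, b)] by the sign of [glue a b], relative to
    the product of the signs of [a] and [b]: [glue] creates [|b| (|a| + 1)]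
    inversions. *)
Definition twmul f g : series R :=
  fun n => \sum_(i < n.+1) (-1) ^+ ((n - i) * i.+1) * (f i * g (n - i)%N).

Lemma twmulDl f1 f2 g : twmul (f1 + f2) g = twmul f1 g + twmul f2 g.
Proof.
apply/seriesP => n; rewrite coefsD /twmul -big_split; apply: eq_bigr => i _ /=.
by rewrite coefsD mulrDl mulrDr.
Qed.

(** The factor [x] makes the right-hand side contracting, so its fixed point is
    determined coefficient by coefficient. *)
Lemma twmul_solution_unique u v f g :
  f = 1 + seriesX * (twmul u f + twmul (f - u) v) ->
  g = 1 + seriesX * (twmul u g + twmul (g - u) v) -> f = g.
Proof.
move=> Ef Eg; apply/seriesP => n; elim/ltn_ind: n => n IHn.
rewrite Ef Eg !coefsD; congr (_ + _).
case: n IHn => [|n] IHn; first by rewrite !coefsXM0.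
rewrite !coefsXM !coefsD /twmul; congr (_ + _); apply: eq_bigr => i _.
  by rewrite IHn // ltnS leq_subr.
by rewrite !coefsB IHn.
Qed.
End SeriesRing.

(** [R_k(x^2)], through the recurrence [R_k(x) = 1 / (1 - x R_(k-1)(x))]. *)
Fixpoint chebRs (R : comNzRingType) k : series R :=
  if k is k1.+1 then geom (seriesX R * chebRs R k1) else 0.
Arguments chebRs : simpl never.

Section Parity.
Variable R : numDomainType.
Implicit Types f g : series R.

Lemma twmul_even f g : conjs f = f -> twmul f g = f * conjs g.
Proof.
move=> f_even; apply/seriesP => n; rewrite coefsM; apply: eq_bigr => i _.
have : f i = (-1) ^+ i * f i by rewrite -{1}f_even.
rewrite /conjs -signr_odd -[in (-1) ^+ (_ * _)]signr_odd oddM /=.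
case: (odd i) => /=; last by rewrite andbT signr_odd => _; ring.
rewrite expr1 mulN1r => /eqP; rewrite -subr_eq0 opprK -mulr2n mulrn_eq0 /=.
by move/eqP->; rewrite !(mul0r, mulr0).
Qed.

Lemma twmul_odd f g : conjs f = - f -> twmul f g = f * g.
Proof.
move=> f_odd; apply/seriesP => n; rewrite coefsM; apply: eq_bigr => i _.
have : - f i = (-1) ^+ i * f i by rewrite -coefsN -f_odd.
rewrite -signr_odd -[in (-1) ^+ (_ * _)]signr_odd oddM /=.
case: (odd i) => /=; first by rewrite andbF => _; ring.
rewrite expr0 mul1r => /esym/eqP; rewrite -subr_eq0 opprK -mulr2n mulrn_eq0 /=.
by move/eqP->; rewrite !(mul0r, mulr0).
Qed.

Local Notation x := (seriesX R).
Local Notation chebRs := (chebRs R).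

Lemma chebRs0 : chebRs 0 = 0. Proof. by []. Qed.

Lemma chebRsS k : chebRs k.+1 * (1 - x ^+ 2 * chebRs k) = 1.
Proof. by rewrite -[RHS](geomE (x * chebRs k)) mulrA. Qed.

Lemma even_inv f g : conjs g = g -> f * g = 1 -> conjs f = f.
Proof.
move=> g_even fg1.
have : conjs f * g = 1 by rewrite -{1}g_even -rmorphM fg1 rmorph1.
by move/(congr1 ( *%R f)); rewrite mulrCA fg1 !mulr1.
Qed.

Lemma chebRs_even k : conjs (chebRs k) = chebRs k.
Proof.
elim: k => [|k IHk]; first exact: rmorph0.
by apply: even_inv (chebRsS k); rewrite rmorphB rmorph1 rmorphM rmorphXn /= conjsX IHk sqrrN.
Qed.

(** Addition formula for the continued fractions.  Passing from the indices
    [(j + 1, k)] to [(j, k + 1)] keeps their sum, and the defining relation of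
    [r_(j + 1)] and that of [r_(k + 1)] turn one formula into the other; this is
    the induction on [j]. *)
Lemma chebRs_addS j k :
  chebRs (j + k).+1 * (1 - x ^+ 2 * (chebRs j + chebRs k)) =
  1 - x ^+ 2 * (chebRs j * chebRs k).
Proof.
elim: j k => [|j IHj] k; first by rewrite chebRs0 add0r mul0r mulr0 subr0 chebRsS.
have := IHj k.+1; rewrite addnS addSn.
move: (chebRsS j) (chebRsS k) (chebRs (j + k).+2).
set a := chebRs j; set a' := chebRs j.+1; set b := chebRs k; set b' := chebRs k.+1.
move=> Ea Eb c Ec.
transitivity (c * (1 - x ^+ 2 * (a + b')) * (a' * (1 - x ^+ 2 * b))
   + c * (1 - (a' * (1 - x ^+ 2 * a))) * (1 - x ^+ 2 * b)
   + c * x ^+ 2 * a' * (b' * (1 - x ^+ 2 * b) - 1)); first by ring.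
rewrite Ea Eb subrr !mulr0 mul0r !addr0 Ec.
transitivity (a' * (1 - x ^+ 2 * a) - x ^+ 2 * a' * b
  - x ^+ 2 * a * a' * ((b' * (1 - x ^+ 2 * b)) - 1)); first by ring.
by rewrite Ea Eb; ring.
Qed.

(** [chebRs_addS] with the last step of [j] undone, so that the index on the left is
    the sum itself. *)
Lemma chebRs_add j k :
  chebRs (j + k) * (1 - x ^+ 2 * (chebRs j * chebRs k)) =
  chebRs j + chebRs k - chebRs j * chebRs k.
Proof.
case: j => [|j]; first by rewrite chebRs0 !mul0r mulr0 !subr0 mulr1 add0r.
have := chebRs_addS j k; rewrite -addSn; move: (chebRsS j) (chebRs (j.+1 + k)).
set a := chebRs j; set a' := chebRs j.+1; set b := chebRs k => Ea c Ec.
transitivity (a' * (c * (1 - x ^+ 2 * (a + b))) + c * (1 - a' * (1 - x ^+ 2 * a)));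
  first by ring.
rewrite Ea subrr mulr0 addr0 Ec.
transitivity (a' - a' * b + b * (a' * (1 - x ^+ 2 * a))); first by ring.
by rewrite Ea; ring.
Qed.

(** The signed counting series shared by the patterns of length [2 j + 1] that occur
    in the construction of odd-wedge patterns. *)
Definition odd_form j : series R := 1 + x * chebRs j.
Definition even_weight j : series R := geom (- (x * chebRs j ^+ 2)).
(** The same for length [2 j]; the factor [even_weight j] is the inverse of
    [1 + x^2 r_j^2]. *)
Definition even_form j : series R :=
  chebRs j * even_weight j + x * (chebRs j ^+ 2 * even_weight j).

Lemma even_weightE j : even_weight j * (1 + x ^+ 2 * chebRs j ^+ 2) = 1.
Proof. by rewrite -[RHS](geomE (- (x * chebRs j ^+ 2))); congr (_ * _); ring. Qed.

Lemma even_weight_even j : conjs (even_weight j) = even_weight j.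
Proof.
apply: even_inv (even_weightE j).
by rewrite rmorphD rmorph1 rmorphM !rmorphXn /= conjsX chebRs_even sqrrN.
Qed.

Lemma mulr_cancel (p d f g : series R) : p * d = 1 -> f * d = g * d -> f = g.
Proof.
by move=> pd /(congr1 ( *%R p)); rewrite !(mulrCA p) pd !mulr1.
Qed.

Lemma conjs_xM f : conjs f = f -> conjs (x * f) = - (x * f).
Proof. by move=> f_even; rewrite rmorphM /= conjsX f_even mulNr. Qed.

Lemma twmul_split fe fo ge go : conjs fe = fe -> conjs fo = fo ->
    conjs ge = ge -> conjs go = go ->
  twmul (fe + x * fo) (ge + x * go) =
  fe * (ge - x * go) + x * fo * (ge + x * go).
Proof.
move=> fe_even fo_even ge_even go_even.
by rewrite twmulDl twmul_even // twmul_odd ?conjs_xM // rmorphD /= conjs_xM // ge_even.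
Qed.

(** Both [u] and the last factor have even part 1, and the odd parts reduce the
    equation to [chebRs_addS]. *)
Lemma odd_form_split j k (f := odd_form (j + k).+1) (u := odd_form j) :
  f = 1 + x * (twmul u f + twmul (f - u) (odd_form k)).
Proof.
rewrite {}/f {}/u /odd_form.
have -> : 1 + x * chebRs (j + k).+1 - (1 + x * chebRs j) =
  0 + x * (chebRs (j + k).+1 - chebRs j) by ring.
rewrite !twmul_split ?rmorphB ?rmorph0 ?rmorph1 /= ?chebRs_even //.
have := chebRs_addS j k; move: (chebRs j) (chebRs k) (chebRs (j + k).+1) => a b c Ec.
transitivity (1 + x * (c * (1 - x ^+ 2 * (a + b)) + x ^+ 2 * c * (a + b))).
  by ring.
by rewrite Ec; ring.
Qed.

(** After clearing the denominators [1 + x^2 r_j^2] and [1 + x^2 r_k^2], the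
    equation is a multiple of [chebRs_add]. *)
Lemma even_form_split j k (f := odd_form (j + k)) (u := even_form j) :
  f = 1 + x * (twmul u f + twmul (f - u) (even_form k)).
Proof.
rewrite {}/f {}/u /odd_form /even_form.
have := (even_weightE j, even_weightE k, chebRs_add j k).
have := (even_weight_even j, even_weight_even k).
set p := even_weight j; set q := even_weight k => -[p_even q_even].
have -> : 1 + x * chebRs (j + k) - (chebRs j * p + x * (chebRs j ^+ 2 * p)) =
  (1 - chebRs j * p) + x * (chebRs (j + k) - chebRs j ^+ 2 * p) by ring.
rewrite !twmul_split ?rmorphB ?rmorph1 ?rmorphM ?rmorphXn /= ?chebRs_even ?p_even ?q_even //.
move: (chebRs j) (chebRs k) (chebRs (j + k)) p q {p_even q_even}.
move=> a b c p q [[Ep Eq] Ec].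
set s := (X in 1 + x * X); congr (1 + x * _).
have pqD : p * q * ((1 + x ^+ 2 * a ^+ 2) * (1 + x ^+ 2 * b ^+ 2)) = 1.
  by rewrite mulrACA Ep Eq mulr1.
apply/esym/(mulr_cancel pqD).
transitivity
  (p * (1 + x ^+ 2 * a ^+ 2) * (1 + x ^+ 2 * b ^+ 2) *
     (a * (1 - x * c) + x * a ^+ 2 * (1 + x * c))
   + q * (1 + x ^+ 2 * b ^+ 2) *
     ((1 + x ^+ 2 * a ^+ 2 - a * (p * (1 + x ^+ 2 * a ^+ 2))) *
        (b - x * b ^+ 2)
      + x * (c * (1 + x ^+ 2 * a ^+ 2) - a ^+ 2 * (p * (1 + x ^+ 2 * a ^+ 2))) *
        (b + x * b ^+ 2))); first by rewrite /s; ring.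
rewrite Ep Eq !mul1r.
(* The two sides differ by a multiple of the relation [Ec]; the cofactor is the
   coefficient of [c] in the difference, divided by [1 - x^2 a b]. *)
transitivity (c * ((1 + x ^+ 2 * a ^+ 2) * (1 + x ^+ 2 * b ^+ 2))
  + (x * (b - a) - (1 + x ^+ 2 * a * b)) *
    (c * (1 - x ^+ 2 * (a * b)) - (a + b - a * b))); first by ring.
by rewrite Ec subrr mulr0 addr0.
Qed.

(** A new maximum after a word of odd length: with [q] empty the equation loses its
    last term, as no permutation avoids the empty pattern. *)
Lemma even_form_rcons j (f := even_form j.+1) :
  f = 1 + x * twmul (odd_form j) f.
Proof.
rewrite {}/f /odd_form /even_form.
have := (even_weightE j.+1, chebRsS j).
have := even_weight_even j.+1; set p := even_weight _ => p_even.
rewrite !twmul_split ?rmorphM ?rmorphXn ?rmorph1 /= ?chebRs_even ?p_even //.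
move: (chebRs j) (chebRs j.+1) p {p_even} => a b p [Ep Eb].
apply/esym.
transitivity (1 - p * (1 + x ^+ 2 * b ^+ 2) + p + p * x * b +
  p * (1 + x * b) * (b - b * (1 - x ^+ 2 * a))); first by ring.
by rewrite Ep Eb; ring.
Qed.
End Parity.

(** * Signed counting series *)

Section SignedSeries.
Variable R : numDomainType.
Local Notation x := (seriesX R).

Definition signed_avoiders (p : seq nat) : series R := fun n =>
  \sum_(w <- avoiders n | ~~ occurs p w) (-1) ^+ inv_count w.

Lemma signed_avoidersE p n : signed_avoiders p n =
  \sum_(w <- avoiders n) (~~ occurs p w)%:R * (-1) ^+ inv_count w.
Proof.
rewrite /signed_avoiders big_mkcond; apply: eq_bigr => w _.
by case: ifP => _; rewrite ?mul1r ?mul0r.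
Qed.

(** [glue a b] avoids [p L q] in one of two exclusive ways: [a] avoids [p] and [b]
    avoids [p L q]; or [a] contains [p] but not [p L q], and [b] avoids [q].  In
    each case the other conditions follow, as [p] and [q] occur wherever [p L q]
    does. *)
Lemma signed_avoiders_rec p q L :
    all (ltn^~ L) p -> all (ltn^~ L) q ->
    allrel (fun x y => y < x)%N p q -> sorted ltn q ->
  let M := signed_avoiders (p ++ L :: q) in
  M = 1 + x * (twmul (signed_avoiders p) M
               + twmul (M - signed_avoiders p) (signed_avoiders q)).
Proof.
move=> p_lt q_lt p_gt_q q_sorted M; apply/seriesP => -[|n]; rewrite coefsD.
  rewrite coefsXM0 coefs1 addr0 /M /signed_avoiders.
  rewrite /avoiders big_filter_cond [permutations _]/= big_cons big_nil.
  case: ifP => [_|]; first by rewrite /= addr0.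
  case/negbT/nandP; rewrite negbK => /occursP[s]; rewrite subseq0 => /eqP->.
    by move/order_iso_size.
  by move/order_iso_size; rewrite size_cat addnS.
rewrite coefsXM coefs1 add0r {}/M signed_avoidersE (perm_big _ (perm_avoidersS n)) /=.
rewrite big_allpairs_dep -[iota 0 n.+1]/(index_iota 0 n.+1) big_mkord /= coefsD /twmul.
rewrite -big_split; apply: eq_bigr => -[i /=]; rewrite ltnS => le_in _.
rewrite big_allpairs coefsB !signed_avoidersE -mulrDr -sumrB !big_distrlr /=.
rewrite -big_split mulr_sumr; apply: eq_big_seq => a.
rewrite mem_avoiders => /andP[_ perm_a] /=.
rewrite -big_split mulr_sumr; apply: eq_big_seq => b.
rewrite mem_avoiders => /andP[_ perm_b] /=.
rewrite (inv_count_glue perm_a perm_b) !exprD /glue.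
have [a_lt b_lt a_gt_b] := glue_shape perm_a perm_b.
rewrite (occurs_split_pivot p_lt q_lt p_gt_q q_sorted a_lt b_lt a_gt_b).
rewrite occurs_mono; last by move=> y z; apply: ltn_add2l.
rewrite (occurs_mono p a); last by move=> y z; apply: ltn_add2l.
have occ_pa := @occurs_catl p (L :: q) a.
have occ_qb : occurs (p ++ L :: q) b -> occurs q b.
  by rewrite -cat1s catA; apply: occurs_catr.
case: (occurs (p ++ L :: q) a) occ_pa => [/(_ isT) -> | _];
case: (occurs (p ++ L :: q) b) occ_qb => [/(_ isT) -> | _];
by case: (occurs p a); case: (occurs q b) => /=; ring.
Qed.

Lemma signed_avoiders_nil : signed_avoiders [::] = 0.
Proof.
apply/seriesP => n; rewrite /signed_avoiders big1 // => w /negP[].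
by apply/occursP; exists [::]; rewrite ?sub0seq.
Qed.

Definition closed_form m : series R :=
  if odd m then odd_form R m./2 else even_form R m./2.

Lemma even_form0 : even_form R 0 = 0.
Proof. by rewrite /even_form chebRs0 expr0n !mul0r mulr0 addr0. Qed.

Lemma twmulr0 (f : series R) : twmul f 0 = 0.
Proof.
by apply/seriesP => n; rewrite /twmul big1 // => i _; rewrite !mulr0.
Qed.

(** The case [q = [::]] of the equation.  The empty pattern occurs everywhere, so its
    series is 0.  As this is also [even_form] at 0, the case of [p] of even length
    is an instance of [even_form_split]. *)
Lemma signed_avoiders_rcons p L : all (ltn^~ L) p ->
    signed_avoiders p = closed_form (size p) ->
  signed_avoiders (rcons p L) = closed_form (size (rcons p L)).
Proof.
move=> p_lt def_p; rewrite -cats1.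
have := signed_avoiders_rec p_lt (isT : all _ [::]) (allrel0r _ _) isT.
rewrite size_cat addn1 signed_avoiders_nil def_p => /twmul_solution_unique; apply.
rewrite /closed_form /= uphalf_half; case: odd.
  by rewrite twmulr0 addr0; apply: even_form_rcons.
by rewrite -even_form0 -[X in odd_form _ X]addn0; apply: even_form_split.
Qed.

Lemma signed_avoiders_cat_inc p t :
    sorted ltn t -> allrel (fun x y => x < y)%N p t ->
    signed_avoiders p = closed_form (size p) ->
  signed_avoiders (p ++ t) = closed_form (size (p ++ t)).
Proof.
elim/last_ind: t => [|t L IHt]; first by rewrite cats0.
rewrite -cats1 allrel_catr allrel1r cats1 => /[dup] sorted_tL.
rewrite (sorted_pairwise ltn_trans) pairwise_rcons -(sorted_pairwise ltn_trans).
case/andP=> t_lt t_sorted /andP[gt_pt p_lt] def_p.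
rewrite -rcons_cat; apply: signed_avoiders_rcons; last exact: IHt.
by rewrite all_cat p_lt.
Qed.

Lemma signed_avoiders_inc t :
  sorted ltn t -> signed_avoiders t = closed_form (size t).
Proof.
move=> t_sorted; apply: (@signed_avoiders_cat_inc [::]) => //.
by rewrite signed_avoiders_nil /closed_form even_form0.
Qed.

(** When the lengths of [p] and [q] have the same parity, their series are both
    [odd_form] or both [even_form], as [odd_form_split] and [even_form_split]
    require. *)
Lemma signed_avoiders_block p q L :
    all (ltn^~ L) p -> all (ltn^~ L) q ->
    allrel (fun x y => y < x)%N p q -> sorted ltn q ->
    odd (size p) = odd (size q) ->
    signed_avoiders p = closed_form (size p) ->
  signed_avoiders (p ++ L :: q) = closed_form (size (p ++ L :: q)).
Proof.
move=> p_lt q_lt p_gt_q q_sorted eq_odd def_p.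
have := signed_avoiders_rec p_lt q_lt p_gt_q q_sorted.
rewrite def_p (signed_avoiders_inc q_sorted) => /twmul_solution_unique; apply.
rewrite size_cat /= addnS /closed_form /= oddD eq_odd addbb /= uphalf_half.
rewrite halfD oddD eq_odd addbb andbb; case: odd => /=.
  by rewrite add0n add1n; apply: odd_form_split.
by rewrite !add0n; apply: even_form_split.
Qed.

(** Induction on the number of blocks.  The last block [(t L, r)] is added by
    appending the increasing word [t] to the previous blocks, then [L r]; since the
    total length is odd, [r] and the word before [L] have lengths of the same
    parity. *)
Lemma odd_wedge_blocks (bs : blocks) :
    all (fun b : seq nat * seq nat => b.1 != [::]) bs ->
    sorted ltn (flatten [seq b.1 | b <- bs]) ->
    allrel (fun x y => y < x)%N
      (flatten [seq b.1 | b <- bs]) (flatten [seq b.2 | b <- bs]) ->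
    all (fun b => sorted ltn b.2) bs ->
    pairwise (fun b c : seq nat * seq nat =>
      allrel (fun x y => y < x)%N b.2 c.2) bs ->
    (forall p, 0 < p <= size bs -> odd (size (blocks_word (take p bs))))%N ->
  signed_avoiders (blocks_word bs) = closed_form (size (blocks_word bs)).
Proof.
elim/last_ind: bs => [|bs [t r] IHbs].
  by move=> *; apply: signed_avoiders_inc.
case/lastP: t => [|t L]; first by rewrite all_rcons.
rewrite !map_rcons !flatten_rcons !all_rcons pairwise_rcons size_rcons /=.
case/andP=> _ bs_neq0.
rewrite (sorted_pairwise ltn_trans) pairwise_cat -!(sorted_pairwise ltn_trans).
case/and3P=> bs_lt_t bs_sorted t_sorted.
rewrite !(allrel_catl, allrel_catr) => /andP[/andP[gt_bs gt_bsr] /andP[gt_tbs gt_tr]].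
case/andP=> r_sorted bsr_sorted /andP[bsr_gt bsr_pair] bs_odd.
have {}IHbs : signed_avoiders (blocks_word bs) = closed_form (size (blocks_word bs)).
  apply: IHbs => // p /andP[p_gt0 le_p].
  have := bs_odd p; rewrite p_gt0 ltnW // -cats1 take_cat.
  by move: le_p; case: ltngtP => // [_ _ -> // | -> _]; rewrite subnn cats0 take_size => ->.
have := bs_odd (size bs).+1; rewrite leqnn => /(_ isT).
rewrite take_oversize ?size_rcons // /blocks_word map_rcons flatten_rcons /=.
rewrite -/(blocks_word bs).
rewrite cat_rcons catA => odd_size.
have in_word y : y \in blocks_word bs ->
    (y \in flatten [seq b.1 | b <- bs]) || (y \in flatten [seq b.2 | b <- bs]).
  case/flattenP=> _ /mapP[b b_bs ->]; rewrite mem_cat => /orP[yb|yb].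
    by apply/orP; left; apply/flattenP; exists b.1; rewrite ?map_f.
  by apply/orP; right; apply/flattenP; exists b.2; rewrite ?map_f.
move/allrelP: bs_lt_t => bs_lt_t; move/allrelP: gt_tbs => gt_tbs.
move/allrelP: gt_tr => gt_tr; move/allrelP: gt_bsr => gt_bsr.
have bs_lt y z : y \in blocks_word bs -> z \in rcons t L -> (y < z)%N.
  by case/in_word/orP=> [/bs_lt_t|/[swap]/gt_tbs]; apply.
have bs_gt y z : y \in blocks_word bs -> z \in r -> (z < y)%N.
  case/flattenP=> _ /mapP[b b_bs ->]; rewrite mem_cat => /orP[yb|yb] zr.
    by apply: gt_bsr => //; apply/flattenP; exists b.1; rewrite ?map_f.
  by move/allP/(_ b b_bs)/allrelP: bsr_gt; apply.
move: t_sorted; rewrite (sorted_pairwise ltn_trans) pairwise_rcons.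
rewrite -(sorted_pairwise ltn_trans) => /andP[t_lt t_sorted].
have Lin : L \in rcons t L by rewrite mem_rcons inE eqxx.
have tin z : z \in t -> z \in rcons t L by rewrite mem_rcons inE orbC => ->.
apply: signed_avoiders_block => //.
- rewrite all_cat t_lt andbT; apply/allP => y y_bs; exact: bs_lt.
- by apply/allP => y yr; apply: gt_tr.
- rewrite allrel_catl; apply/andP; split; apply/allrelP => y z; first exact: bs_gt.
  by move=> /tin; apply: gt_tr.
- move: odd_size; rewrite [size (_ ++ L :: r)]size_cat /= addnS /= oddD.
  by case: odd; case: odd.
apply: signed_avoiders_cat_inc => //; apply/allrelP => y z y_bs /tin.
exact: bs_lt.
Qed.
End SignedSeries.

(** * Chebyshev polynomials and the theorem *)

Lemma occurs_perm_word l (tau : 'S_l) w :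
  occurs (perm_word tau) w = occurs (word tau) w.
Proof. by rewrite perm_wordE occurs_map_pattern. Qed.

Lemma gfME l (tau : 'S_l) n :
  (gfM tau n)%:~R = signed_avoiders rat (perm_word tau) n.
Proof.
rewrite /signed_avoiders /avoiders big_filter_cond -(perm_big _ (perm_words n)) /=.
rewrite big_map big_enum_cond /= (bigID (@odd_perm _)) /= addrC.
rewrite /gfM /gfE /gfO rmorphB /= -!pmulrn -!sumr_const -sumrN.
have avoidersE b s : (~~ occurs [:: 0; 2; 1]%N (word s) &&
    ~~ occurs (perm_word tau) (word s)) && b =
  [&& avoids p132 s, avoids tau s & b].
  by rewrite /avoids !containsE word_p132 occurs_perm_word andbA.
congr (_ + _); apply: eq_big => s; rewrite ?avoidersE ?inE // => /and3P[_ _].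
  by rewrite odd_perm_inv_count -signr_odd => /negPf->.
by rewrite odd_perm_inv_count -signr_odd => ->.
Qed.

(** [x^k U_k(1 / (2 x))], a polynomial; see [horner_Rden]. *)
Fixpoint Rden (R : nzRingType) k : {poly R} :=
  match k with
  | 0 | 1 => 1
  | (k2.+1 as k1).+1 => Rden R k1 - 'X ^+ 2 * Rden R k2
  end.

Arguments Rden : simpl never.

Lemma RdenSS (R : nzRingType) k : Rden R k.+2 = Rden R k.+1 - 'X ^+ 2 * Rden R k.
Proof. by []. Qed.

Lemma Rden_horner0 (R : comNzRingType) k : (Rden R k).[0] = 1.
Proof.
suff: (Rden R k).[0] = 1 /\ (Rden R k.+1).[0] = 1 by case.
elim: k => [|k [IH0 IH1]]; first by rewrite /Rden -polyC1 hornerC.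
by split=> //; rewrite RdenSS !hornerE IH1 IH0; ring.
Qed.

Lemma chebRs_den (R : numDomainType) k :
  chebRs R k.+1 * series_poly (Rden R k.+1) = series_poly (Rden R k).
Proof.
elim: k => [|k IHk].
  by have := chebRsS R 0; rewrite chebRs0 mulr0 subr0 rmorph1 => ->.
rewrite RdenSS rmorphB rmorphM rmorphXn /= -/(seriesX R) -IHk.
transitivity (chebRs R k.+2 * (1 - seriesX R ^+ 2 * chebRs R k.+1) *
   series_poly (Rden R k.+1)); first by ring.
by rewrite chebRsS mul1r.
Qed.

Lemma horner_Rden (R : comNzRingType) (y t : R) k :
  y * (2%:R * t) = 1 -> (Rden R k).[y] = y ^+ k * (chebU R k).[t].
Proof.
move=> yt; suff: (Rden R k).[y] = y ^+ k * (chebU R k).[t] /\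
  (Rden R k.+1).[y] = y ^+ k.+1 * (chebU R k.+1).[t] by case.
elim: k => [|k [IH0 IH1]].
  by rewrite /Rden /= -polyC1 !hornerC hornerZ hornerX mul1r expr1 yt.
split=> //; rewrite RdenSS chebU_rec !hornerE IH0 IH1.
transitivity (y ^+ k.+1 * (chebU R k.+1).[t] * (y * (2%:R * t))
   - y ^+ 2 * (y ^+ k * (chebU R k).[t])); first by rewrite yt mulr1.
by rewrite !exprS; ring.
Qed.

Lemma chebR_Rden (F : fieldType) (y : F) k : 2%:R != 0 :> F -> y != 0 ->
  chebR k.+1 y = (Rden F k).[y] / (Rden F k.+1).[y].
Proof.
move=> n2 ny; rewrite /chebR; set t := 1 / _.
have yt : y * (2%:R * t) = 1 by rewrite /t; field; apply/andP; split.
have yk : y ^+ k != 0 by rewrite expf_neq0.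
by rewrite !(horner_Rden _ yt) exprSr -mulrA -mulf_div divff // mul1r.
Qed.

(** A polynomial is its own value at the indeterminate; this lets [chebR_Rden], which
    is proved in an arbitrary field, apply to the rational functions. *)
Lemma tofrac_Rden k : tofrac (Rden rat k) = (Rden ratfun k).[ratX].
Proof.
suff: tofrac (Rden rat k) = (Rden ratfun k).[ratX] /\
      tofrac (Rden rat k.+1) = (Rden ratfun k.+1).[ratX] by case.
elim: k => [|k [IH0 IH1]]; first by rewrite /Rden -!polyC1 !hornerC polyC1 tofrac1.
by split=> //; rewrite !RdenSS tofracB tofracM tofracXn IH0 IH1 !hornerE.
Qed.

Definition Rnum k : {poly rat} := if k is k1.+1 then Rden _ k1 else 0.

Lemma series_Rnum k :
  series_poly (Rden rat k) * chebRs rat k = series_poly (Rnum k).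
Proof.
case: k => [|k]; first by rewrite chebRs0 mulr0 rmorph0.
by rewrite mulrC chebRs_den.
Qed.

Lemma chebR_frac k : chebR k ratX = tofrac (Rnum k) / tofrac (Rden rat k).
Proof.
case: k => [|k]; first by rewrite /Rnum rmorph0 mul0r.
rewrite chebR_Rden ?tofrac_Rden //; last by rewrite tofrac_eq0 polyX_eq0.
by rewrite -tofrac1 -tofracMn tofrac_eq0 -polyC1 -polyCMn polyC_eq0.
Qed.

Theorem theorem2p25 (k : nat) (tau : 'S_(2 * k + 1))
  (tau_avoids : avoids p132 tau) (tau_ow : odd_wedge_pattern tau) :
  (* sqrt(x^2) = x, so R_k(x^2) is chebR k x *)
  expands_to (1 + ratX * chebR k ratX)%R (gfM tau).
Proof.
have [s [bs [[word_tau bs_neq0 tau_inc rho_perm [rho_sorted rho_layers]] bs_odd]]] := tau_ow.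
have closed_tau : signed_avoiders rat (perm_word tau) = odd_form rat k.
  rewrite word_tau odd_wedge_blocks //; last 2 first.
  - by rewrite tau_inc iota_ltn_sorted.
  - apply/allrelP => y z; rewrite tau_inc (perm_mem rho_perm) !mem_iota.
    by lia.
  rewrite -word_tau size_map size_enum_ord /closed_form addn1 mul2n /= odd_double.
  by rewrite uphalf_double.
have den_neq0 : Rden rat k != 0.
  by apply: contraTneq (oner_neq0 rat) => den_k; rewrite -(Rden_horner0 _ k) den_k horner0 eqxx.
exists (Rden rat k + 'X * Rnum k), (Rden rat k); split.
- by rewrite Rden_horner0 oner_neq0.
- rewrite chebR_frac tofracD tofracM -/ratX.
  have : tofrac (Rden rat k) != 0 by rewrite tofrac_eq0.
  by rewrite mulrDl mulrA => /divff->.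
move=> n; under eq_bigr do rewrite gfME closed_tau.
rewrite -[LHS]/((series_poly (Rden rat k) * odd_form rat k) n).
rewrite -[RHS]/(series_poly (Rden rat k + 'X * Rnum k) n).
by rewrite /odd_form mulrDr mulr1 mulrCA series_Rnum rmorphD rmorphM.
Qed.
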